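(* Let $(U_t)_{t\in\mathbb{R}}$ be a reflection positive unitary one-parameter group on the reflection positive Hilbert space $(\mathcal{E},\mathcal{E}_+,\theta)$. Suppose that $\mathcal{E}_+$ is $U$-cyclic, and write $(\widehat U_t)_{t\ge 0}$ for the one-parameter semigroup of contractions induced by $U$ on $\widehat{\mathcal{E}}$. Let $\mathcal{E}_{\rm fix}$ denote the subspace of elements of $\mathcal{E}$ fixed under all $U_t$, $t \in \mathbb{R}$, and $\widehat{\mathcal{E}}_{\rm fix}$ the subspace of elements of $\widehat{\mathcal{E}}$ fixed under all $\widehat U_t$, $t>0$. Then: (a) $\mathcal{E}_{\rm fix}\subseteq \mathcal{E}_0$, the space of $\theta$-fixed points in $\mathcal{E}_+$. (b) The map $\mathcal{E}_{\rm fix}\to\widehat{\mathcal{E}}_{\rm fix}$, $v\mapsto\widehat v$, is a unitary isomorphism. (c) $\mathcal{E}_{\rm fix}=\mathcal{E}_\infty:=\bigcap_{t>0}U_t\mathcal{E}_+$.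
   Context: A reflection positive Hilbert space is a triple $(\mathcal{E},\mathcal{E}_+,\theta)$, where $\mathcal{E}$ is a complex Hilbert space, $\theta$ is a unitary involution on $\mathcal{E}$ ($\theta^2=1$) and $\mathcal{E}_+\subseteq\mathcal{E}$ is a closed subspace which is $\theta$-positive: $\langle\theta v,v\rangle\ge 0$ for all $v\in\mathcal{E}_+$. Put $\mathcal{N}=\{v\in\mathcal{E}_+:\langle\theta v,v\rangle=0\}$ (a closed subspace, equal to $\mathcal{E}_+\cap\theta(\mathcal{E}_+)^\perp$), let $\widehat{\mathcal{E}}$ be the Hilbert space completion of $\mathcal{E}_+/\mathcal{N}$ with respect to the norm $\|\widehat v\|=\sqrt{\langle\theta v,v\rangle}$, and let $q:\mathcal{E}_+\to\widehat{\mathcal{E}}$, $v\mapsto\widehat v$, be the canonical map. Put $\mathcal{E}_0=\{v\in\mathcal{E}_+:\theta v=v\}$. A reflection positive unitary one-parameter group on $(\mathcal{E},\mathcal{E}_+,\theta)$ is a strongly continuous unitary one-parameter group $(U_t)_{t\in\mathbb{R}}$ on $\mathcal{E}$ with $U_t\mathcal{E}_+\subseteq\mathcal{E}_+$ for $t>0$ and $\theta U_t\theta=U_{-t}$ for $t\in\mathbb{R}$. It induces a strongly continuous one-parameter semigroup $(\widehat U_t)_{t\ge0}$ of self-adjoint contractions on $\widehat{\mathcal{E}}$ determined by $\widehat U_t\widehat v=\widehat{U_tv}$ for $v\in\mathcal{E}_+$. A subspace of $\mathcal{E}$ is called $U$-cyclic if its translates under all $U_t$, $t\in\mathbb{R}$,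 span a dense subspace of $\mathcal{E}$. *)

(* Defs.v *)
From HB Require Import structures.
From mathcomp Require Import all_boot all_order all_algebra.
From mathcomp Require Import complex.
From mathcomp Require Import all_classical all_reals all_analysis.

Set Implicit Arguments.
Unset Strict Implicit.
Unset Printing Implicit Defensive.

Import Order.TTheory GRing.Theory Num.Theory.
Import numFieldNormedType.Exports.
Local Open Scope classical_set_scope.
Local Open Scope ring_scope.

(* Norms take values in R[i]; the order on R[i] is the partial one, so that
   0 <= z says that z is real and nonnegative. *)
HB.mixin Record CompleteNormedModule_isHilbert (R : realType) H
    & CompleteNormedModule R[i] H := {
  hform : {dot H for (@Num.conj R[i])} ;
  hform_normE : forall v : H, `|v| ^+ 2 = hform v v
}.

#[short(type="hilbertType")]
HB.structure Definition Hilbert (R : realType) :=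
  {H of CompleteNormedModule_isHilbert R H & CompleteNormedModule R[i] H}.

(* Linear in the first argument, conjugate-linear in the second. *)
Definition inner (R : realType) (H : hilbertType R) (v w : H) : R[i] :=
  (hform : {dot H for (@Num.conj R[i])}) v w.

Definition subspace (R : realType) (H : hilbertType R) (A : set H) : Prop :=
  A 0 /\ forall (a : R[i]) v w, A v -> A w -> A (a *: v + w).

Definition span (R : realType) (H : hilbertType R) (A : set H) : set H :=
  smallest (@subspace R H) A.

(* Maps defined on a subspace A are represented by total functions whose values
   outside A are irrelevant. *)
Definition linear_on (R : realType) (H K : hilbertType R) (A : set H)
    (f : H -> K) : Prop :=
  forall (a : R[i]) v w, A v -> A w -> f (a *: v + w) = a *: f v + f w.

Definition unitary_iso (R : realType) (H K : hilbertType R) (A : set H)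
    (B : set K) (f : H -> K) : Prop :=
  [/\ linear_on A f, set_bij A B f &
      forall v w, A v -> A w -> inner (f v) (f w) = inner v w].

Definition unitary (R : realType) (H : hilbertType R) (f : H -> H) : Prop :=
  unitary_iso setT setT f.

Definition reflection_positive_space (R : realType) (E : hilbertType R)
    (Eplus : set E) (theta : E -> E) : Prop :=
  [/\ unitary theta,
      forall v, theta (theta v) = v,
      subspace Eplus, closed Eplus &
      forall v, Eplus v -> 0 <= inner (theta v) v].

(* Hilbert spaces K together with q : Eplus -> K realizing the completion of
   Eplus / N, N = {v in Eplus | inner (theta v) v = 0}.  The norm identity forces
   the kernel of q to be exactly N, so q factors through an isometric linear map
   on Eplus / N, whose range is dense; (K, q) is thus the completion, which is
   unique up to a unique unitary isomorphism. *)
Definition quotient_completion (R : realType) (E : hilbertType R)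
    (Eplus : set E) (theta : E -> E) (K : hilbertType R) (q : E -> K) : Prop :=
  [/\ linear_on Eplus q,
      forall v, Eplus v -> `|q v| = sqrtC (inner (theta v) v) &
      dense (q @` Eplus)].

Definition unitary_group (R : realType) (E : hilbertType R)
    (U : R -> E -> E) : Prop :=
  [/\ forall t, unitary (U t),
      forall v, U 0 v = v,
      forall s t v, U (s + t) v = U s (U t v) &
      forall v, continuous (fun t : R => U t v)].

Definition reflection_positive_group (R : realType) (E : hilbertType R)
    (Eplus : set E) (theta : E -> E) (U : R -> E -> E) : Prop :=
  [/\ unitary_group U,
      forall t, 0 < t -> U t @` Eplus `<=` Eplus &
      forall t v, theta (U t (theta v)) = U (- t) v].

Definition cyclic_subspace (R : realType) (E : hilbertType R)
    (U : R -> E -> E) (A : set E) : Prop :=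
  dense (span (\bigcup_(t in [set: R]) (U t @` A))).

(* As q has dense range on Eplus, these conditions determine Uhat t for t >= 0;
   its semigroup law, self-adjointness and strong continuity follow from those
   of U and need not be assumed.  Uhat t is irrelevant for t < 0. *)
Definition induced_semigroup (R : realType) (E : hilbertType R)
    (Eplus : set E) (U : R -> E -> E) (K : hilbertType R) (q : E -> K)
    (Uhat : R -> K -> K) : Prop :=
  forall t, 0 <= t ->
    [/\ linear_on setT (Uhat t),
        forall x, `|Uhat t x| <= `|x| &
        forall v, Eplus v -> Uhat t (q v) = q (U t v)].

Definition theta_fixed (R : realType) (E : hilbertType R) (Eplus : set E)
    (theta : E -> E) : set E := [set v | Eplus v /\ theta v = v].

Definition group_fixed (R : realType) (E : hilbertType R)
    (U : R -> E -> E) : set E := [set v | forall t, U t v = v].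

Definition semigroup_fixed (R : realType) (K : hilbertType R)
    (Uhat : R -> K -> K) : set K := [set x | forall t, 0 < t -> Uhat t x = x].

Definition Einfty (R : realType) (E : hilbertType R) (Eplus : set E)
    (U : R -> E -> E) : set E :=
  \bigcap_(t in [set t : R | 0 < t]) (U t @` Eplus).

(* Main.v *)
Require Import Defs.
From HB Require Import structures.
From mathcomp Require Import all_boot all_order all_algebra.
From mathcomp Require Import complex.
From mathcomp Require Import all_classical all_reals all_analysis.
From mathcomp Require Import ring lra.

Set Implicit Arguments.
Unset Strict Implicit.
Unset Printing Implicit Defensive.

Import Order.TTheory GRing.Theory Num.Theory.
Import numFieldNormedType.Exports.
Local Open Scope classical_set_scope.
Local Open Scope ring_scope.

(** The fixed vectors of U are reached without integrating over the group.
Given w in Eplus, the convex hull of the forward orbit of w contains minimizing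
sequences for the norm, all converging to one point m; as the U t with t >= 0
are linear isometries preserving the hull, they fix m ([orbit_mean], the
argument of Alaoglu and Birkhoff).  The vector m inherits every closed convex
condition satisfied along the forward orbit, and this is used three times: m
lies in Eplus, w - m is orthogonal to all fixed vectors, and q m is at least as
close as q w to any fixed vector x of the semigroup, because the Uhat t are
contractions fixing x.

(a) By cyclicity a fixed vector v is a limit of combinations d of vectors
U t w with w in Eplus.  Replacing each U t w by the m attached to w turns d into
a fixed vector of Eplus which is the orthogonal projection of d to the fixed
vectors, hence at least as close to v as d.  So v is in the closed set Eplus
([group_fixed_Eplus]).  Now theta preserves the fixed vectors, and v - theta v
is a vector of Eplus sent to its opposite by theta; positivity kills it
([group_fixed_theta]).

(b) On fixed vectors theta is the identity, so q is isometric there.  For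
surjectivity, x fixed by the semigroup is a limit of vectors q w with w in
Eplus, hence of vectors q m with m fixed; completeness and the isometry of q
give a fixed vector above x ([quotient_fixed_surj]).

(c) If v lies in every U t Eplus with t > 0, its whole orbit stays in Eplus and
the inner product of q (U s v) and q (U t v) depends on s + t only, because
theta U s = U (- s) theta.  Expanding the square of q (U s v) - q (U t v) then
shows that t |-> `|q (U t v)| ^+ 2 is midpoint convex on the whole line; being
bounded, it is constant, so q (U t v) does not depend on t
([quotient_orbit_cst]).  This plays the part of the spectral theorem for the
generator of Uhat.  Consequently theta (U t v - v) is orthogonal to all
translates of Eplus and vanishes by cyclicity ([Einfty_group_fixed]). *)

(** * The inner product of a Hilbert space *)

Section Inner.
Context (R : realType) (H : hilbertType R).
Implicit Types (u v w : H) (a : R[i]).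

Lemma innerC v w : inner w v = (inner v w)^*.
Proof. by rewrite /inner hermC expr0 mul1r. Qed.

Lemma innerDl u v w : inner (u + v) w = inner u w + inner v w.
Proof. exact: linearDl. Qed.

Lemma innerBl u v w : inner (u - v) w = inner u w - inner v w.
Proof. exact: linearBl. Qed.

Lemma innerZl a v w : inner (a *: v) w = a * inner v w.
Proof. exact: linearZl_LR. Qed.

Lemma innerDr u v w : inner w (u + v) = inner w u + inner w v.
Proof. exact: linearDr. Qed.

Lemma innerBr u v w : inner w (u - v) = inner w u - inner w v.
Proof. exact: linearBr. Qed.

Lemma innerZr a v w : inner w (a *: v) = a^* * inner w v.
Proof. exact: linearZr_LR. Qed.

Lemma inner0l v : inner 0 v = 0.
Proof. exact: linear0l. Qed.

Lemma normE v : `|v| ^+ 2 = inner v v.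
Proof. exact: hform_normE. Qed.

Lemma inner_eq0C v w : inner v w = 0 -> inner w v = 0.
Proof. by move=> vw; rewrite innerC vw conjC0. Qed.

Lemma pythagoras v w : inner v w = 0 -> `|v - w| ^+ 2 = `|v| ^+ 2 + `|w| ^+ 2.
Proof.
move=> vw; rewrite !normE innerBl !innerBr vw (inner_eq0C vw).
by rewrite subr0 sub0r opprK.
Qed.

Lemma parallelogram v w :
  `|v - w| ^+ 2 =
  2 * `|v| ^+ 2 + 2 * `|w| ^+ 2 - 4 * `|2^-1 *: (v + w)| ^+ 2.
Proof.
rewrite !normE innerBl !innerBr innerZl innerZr innerDl !innerDr.
rewrite fmorphV rmorph_nat; by field.
Qed.

(** The vector `|w| ^+ 2 *: v - inner v w *: w is `|w| ^+ 2 times the component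
of v orthogonal to w, which keeps the computation free of division. *)
Lemma cauchy_schwarz v w : `|inner v w| <= `|v| * `|w|.
Proof.
have [->|w0] := eqVneq w 0.
  by rewrite innerC inner0l conjC0 !normr0 mulr0.
rewrite -ler_sqr ?nnegrE ?mulr_ge0// exprMn.
have n0 : 0 < `|w| ^+ 2 by rewrite exprn_gt0// normr_gt0.
have := exprn_ge0 2 (normr_ge0 (`|w| ^+ 2 *: v - inner v w *: w)).
have -> : `| `|w| ^+ 2 *: v - inner v w *: w| ^+ 2 =
          `|w| ^+ 2 * (`|v| ^+ 2 * `|w| ^+ 2 - `|inner v w| ^+ 2).
  rewrite (normE (_ - _)) innerBl !innerBr !innerZl !innerZr -!normE.
  rewrite normCK -(innerC v w) geC0_conj ?exprn_ge0//.
  by ring.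
by rewrite pmulr_rge0// subr_ge0.
Qed.

End Inner.

(** * Completeness *)

Section Completeness.
Context (R : realType) (H : completeNormedModType R[i]).

Lemma closure_normP (A : set H) (l : H) :
  closure A l <-> forall e : R[i], 0 < e -> exists2 a, A a & `|l - a| < e.
Proof.
split=> [cl e e0|cl B].
  have [a [Aa la]] := cl _ (nbhsx_ballx l e e0).
  by exists a => //; move: la; rewrite -ball_normE.
rewrite -nbhs_ballE => -[e /= e0 eB].
have [a Aa la] := cl e e0.
by exists a; split=> //; apply: eB; rewrite -ball_normE.
Qed.

(** Cantor's intersection theorem: the sets S r generate a Cauchy filter. *)
Lemma nested_closure (S : R[i] -> set H) :
  (forall r, 0 < r -> S r !=set0) ->
  (forall r s, 0 < r -> r <= s -> S r `<=` S s) ->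
  (forall e, 0 < e -> exists2 r, 0 < r &
     forall a b, S r a -> S r b -> `|a - b| < e) ->
  exists l, forall r, 0 < r -> closure (S r) l.
Proof.
move=> S0 Smono Sdiam.
pose F := filter_from [set r : R[i] | 0 < r] S.
have FF : Filter F.
  apply: filter_from_filter; first by exists 1; rewrite /= ltr01.
  move=> i j /= i0 j0; exists (i * j / (i + j)).
    by rewrite /= divr_gt0 ?mulr_gt0 ?addr_gt0.
  (* i * j / (i + j) is below both i and j; the order of R[i] is partial, so this
     is handier than a minimum. *)
  have ij0 : 0 < i * j / (i + j) by rewrite divr_gt0 ?mulr_gt0 ?addr_gt0.
  have ij : 0 < i + j by rewrite addr_gt0.
  move=> a Sa; split; apply: Smono Sa => //; rewrite ler_pdivrMr//.
    by rewrite ler_pM2l// lerDr ltW.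
  by rewrite mulrC ler_pM2l// lerDl ltW.
have PF : ProperFilter F by apply: filter_from_proper => // r r0; exact: S0.
have cF : cauchy F.
  apply/cauchy_ballP => e e0.
  have [r r0 Sr] := Sdiam e e0.
  exists (S r, S r) => /=; first by split; exists r.
  move=> [a b] [/= Sa Sb]; rewrite -ball_normE; exact: Sr.
have Fl : cvg F by exact: (@cauchy_cvg H).
exists (lim F) => r r0 B Bl.
have FB : F (S r `&` B) by apply: filterI; [exists r | exact: Fl].
have [t t0 tB] := FB.
by have [c /tB] := S0 t t0; exists c.
Qed.

End Completeness.

(** * Common fixed points of isometries *)

(** Midpoints are the only convex combinations that the parallelogram law needs;
for closed sets this is convexity. *)
Definition midpoint_closed (R : realType) (H : hilbertType R) (C : set H) :=
  forall a b, C a -> C b -> C (2^-1 *: (a + b)).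

Section FixedPoint.
Context (R : realType) (H : hilbertType R).

Lemma sqr_norm_real (v : H) : `|v| ^+ 2 = (complex.Re (`|v| ^+ 2))%:C%C.
Proof. by rewrite RRe_real// ger0_real// exprn_ge0. Qed.

(** The near-minimizers of the norm on C cluster, by the parallelogram law, at a
single point m.  An isometry preserving C sends near-minimizers to
near-minimizers, so it must fix m. *)
Lemma exists_isometry_fixed_point (C : set H) :
  C !=set0 -> midpoint_closed C ->
  exists2 m, closure C m &
    forall f : H -> H, (forall a b, f (a - b) = f a - f b) ->
      (forall a, `|f a| = `|a|) -> (forall a, C a -> C (f a)) -> f m = m.
Proof.
move=> [c0 Cc0] Cmid.
pose N (c : H) := complex.Re (`|c| ^+ 2 : R[i]).
pose d := inf [set N c | c in C].
have N0 c : 0 <= N c by rewrite -lecR -sqr_norm_real exprn_ge0.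
have lbN : has_lbound [set N c | c in C] by exists 0 => _ [c _ <-].
have dN c : C c -> d%:C%C <= `|c| ^+ 2.
  by move=> Cc; rewrite sqr_norm_real lecR; apply: ge_inf => //; exists c.
pose S (r : R[i]) := [set c | C c /\ `|c| ^+ 2 < d%:C%C + r].
have S0 r : 0 < r -> S r !=set0.
  move=> r0.
  have r0' : 0 < complex.Re r by rewrite -ltcR RRe_real// gtr0_real.
  have [_ [c Cc <-] cd] : exists2 x, [set N c | c in C] x & x < d + complex.Re r.
    by apply: inf_adherent => //; split=> //; exists (N c0), c0.
  exists c; split=> //; rewrite sqr_norm_real -(RRe_real (gtr0_real r0)).
  by rewrite -rmorphD/= ltcR.
have Smono r s : 0 < r -> r <= s -> S r `<=` S s.
  by move=> r0 rs a [Ca ar]; split=> //; apply: lt_le_trans ar _; rewrite lerD2l.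
(* With both squared norms below d + e ^ 2 / 4 and the midpoint at least d, the
   parallelogram law leaves exactly e ^ 2. *)
have Sdiam e : 0 < e -> exists2 r, 0 < r &
    forall a b, S r a -> S r b -> `|a - b| < e.
  move=> e0; exists (e ^+ 2 / 4); first by rewrite divr_gt0// exprn_gt0.
  move=> a b [Ca ar] [Cb br].
  rewrite -ltr_sqr ?nnegrE ?(ltW e0)// parallelogram.
  have dab := dN _ (Cmid _ _ Ca Cb).
  rewrite ltrBlDr.
  apply: (@lt_le_trans _ _ (2 * (d%:C%C + e ^+ 2 / 4) + 2 * (d%:C%C + e ^+ 2 / 4))).
    by rewrite ltrD// ltr_pM2l.
  rewrite [leLHS](_ : _ = e ^+ 2 + 4 * d%:C%C); last by field.
  by rewrite lerD2l ler_pM2l.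
have [m mS] := nested_closure S0 Smono Sdiam.
exists m.
  have : closure (S 1) m by exact: mS.
  by apply: closure_subset => a [].
move=> f fB fN fC.
apply/eqP; rewrite -subr_eq0 -normr_eq0; apply/negPn/negP => n0.
have e0 : 0 < `|f m - m| / 3 by rewrite divr_gt0// lt_def n0/=.
have [r r0 Sr] := Sdiam _ e0.
have [a Sa ma] := (closure_normP _ _).1 (mS r r0) _ e0.
have Sfa : S r (f a) by case: Sa => Ca ar; split; [exact: fC | rewrite fN].
have faa := Sr _ _ Sfa Sa.
suff : `|f m - m| < `|f m - m| by rewrite ltxx.
have {1}-> : f m - m = f (m - a) + (f a - a) + (a - m).
  by rewrite fB !addrA !subrK.
apply: le_lt_trans (ler_normD _ _) _.
apply: le_lt_trans (lerD (ler_normD _ _) (lexx _)) _.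
rewrite fN (distrC a m).
rewrite [ltRHS](_ : _ = `|f m - m| / 3 + `|f m - m| / 3 + `|f m - m| / 3); last by field.
by rewrite !ltrD.
Qed.

End FixedPoint.

(** * Midpoint convex functions on the line *)

(** Were g s < g t, the increments of g along the arithmetic progression from s
through t would be nondecreasing and start at a positive value, so that g would
grow at least linearly. *)
Lemma bounded_midpoint_convex_cst (R : realType) (g : R -> R) (M : R) :
  (forall t, g t <= M) -> (forall s t, 2 * g (2^-1 * (s + t)) <= g s + g t) ->
  forall s t, g s = g t.
Proof.
move=> gM gconv; suff g_le s t : g t <= g s.
  by move=> s t; apply/eqP; rewrite eq_le !g_le.
rewrite leNgt; apply/negP => gst.
pose x n := s + n%:R * (t - s).
pose D := g t - g s.
have D0 : 0 < D by rewrite subr_gt0.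
have incr n : D <= g (x n.+1) - g (x n).
  elim: n => [|n IH].
    by rewrite /x mul1r mul0r addr0 (addrC s) subrK.
  have := gconv (x n) (x n.+2).
  have -> : 2^-1 * (x n + x n.+2) = x n.+1.
    by rewrite /x -[n.+2]addn2 -[n.+1]addn1 !natrD; field.
  lra.
have grow n : n%:R * D <= g (x n) - g s.
  elim: n => [|n IH]; first by rewrite /x !mul0r addr0 subrr.
  have := incr n; rewrite -[n.+1]addn1 natrD mulrDl mul1r; lra.
have := archi_boundP (x := (M - g s) / D).
rewrite divr_ge0 ?(ltW D0) ?subr_ge0 ?gM// => /(_ isT).
set n := Num.Def.archi_bound _.
by rewrite ltr_pdivrMr// ltNge (le_trans (grow n))// lerD2r.
Qed.

(** * Subspaces and maps linear on them *)

Section LinearOn.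
Context (R : realType) (H K : hilbertType R) (A : set H) (f : H -> K).
Context (sA : Defs.subspace A) (lf : linear_on A f).

Lemma subspaceD v w : A v -> A w -> A (v + w).
Proof. by move=> Av Aw; rewrite -[v]scale1r; apply: sA.2. Qed.

Lemma subspaceZ a v : A v -> A (a *: v).
Proof. by move=> Av; rewrite -[_ *: _]addr0; apply: sA.2 => //; exact: sA.1. Qed.

Lemma subspaceB v w : A v -> A w -> A (v - w).
Proof. by move=> Av Aw; rewrite addrC -scaleN1r; apply: sA.2. Qed.

Lemma subspace_midpoint_closed : midpoint_closed A.
Proof. by move=> v w Av Aw; apply: subspaceZ; exact: subspaceD. Qed.

Lemma linear_onD v w : A v -> A w -> f (v + w) = f v + f w.
Proof. by move=> Av Aw; rewrite -[v in LHS]scale1r lf// scale1r. Qed.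

Lemma linear_onB v w : A v -> A w -> f (v - w) = f v - f w.
Proof. by move=> Av Aw; rewrite addrC -scaleN1r lf// scaleN1r addrC. Qed.

Lemma linear_on0 : f 0 = 0.
Proof. by rewrite -(subrr 0) linear_onB ?subrr//; exact: sA.1. Qed.

Lemma linear_onZ a v : A v -> f (a *: v) = a *: f v.
Proof.
by move=> Av; rewrite -[_ *: v]addr0 lf ?linear_on0 ?addr0//; exact: sA.1.
Qed.

End LinearOn.

Lemma subspaceT (R : realType) (H : hilbertType R) : Defs.subspace [set: H].
Proof. by []. Qed.

(** For D sesquilinear on A, expanding D at a *: v + w for a = 1 and a = 'i gives
the sum and the difference of D v w and D w v.  Applied to a difference of two
forms, this recovers a form from its diagonal. *)
Lemma polarization (R : realType) (H : hilbertType R) (A : set H)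
    (D : H -> H -> R[i]) :
  Defs.subspace A ->
  (forall a v v' w, A v -> A v' -> A w -> D (a *: v + v') w = a * D v w + D v' w) ->
  (forall a v w w', A v -> A w -> A w' -> D v (a *: w + w') = a^* * D v w + D v w') ->
  (forall v, A v -> D v v = 0) -> forall v w, A v -> A w -> D v w = 0.
Proof.
move=> sA Dl Dr D0 v w Av Aw.
have E a : a * D v w + a^* * D w v = 0.
  have Aavw : A (a *: v + w) by apply: sA.2.
  have := D0 _ Aavw; rewrite Dl// !Dr// !D0//.
  by rewrite mulr0 add0r addr0.
have := E 1; rewrite conjC1 !mul1r => /eqP; rewrite addr_eq0 => /eqP vw.
have := E 'i; rewrite conjCi vw mulrN mulNr -opprD => /eqP.
rewrite oppr_eq0 -mulr2n mulrn_eq0/= mulf_eq0 (negPf (neq0Ci _))/= => /eqP ->.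
by rewrite oppr0.
Qed.

(** * Density and orthogonality *)

Section Density.
Context (R : realType) (H : hilbertType R).

Lemma dense_normP (D : set H) (v : H) (e : R[i]) :
  dense D -> 0 < e -> exists2 d, D d & `|v - d| < e.
Proof.
move=> dD e0; have [d [vd Dd]] : ((ball v e)° `&` D) !=set0.
  apply: dD; last exact: open_interior.
  by exists v; apply: nbhs_singleton; apply: nbhs_interior; exact: nbhsx_ballx.
exists d => //; have := interior_subset vd; by rewrite -ball_normE.
Qed.

(** A vector d of the span is orthogonal to v, so by Pythagoras its distance to v is
at least `|v|, whereas density provides d closer than that. *)
Lemma orthogonal_dense_span (A : set H) (v : H) :
  dense (Defs.span A) -> (forall w, A w -> inner w v = 0) -> v = 0.
Proof.
move=> dA Av; apply/eqP; rewrite -normr_eq0; apply/negPn/negP => v0.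
have v_gt0 : 0 < `|v| by rewrite lt_def v0/=.
have [d Ad] := dense_normP v dA v_gt0.
have dv : inner d v = 0.
  move: d Ad; apply: smallest_sub => //; split; first exact: inner0l.
  by move=> a u w /= uv wv; rewrite innerDl innerZl uv wv mulr0 addr0.
rewrite -ltr_sqr ?nnegrE// pythagoras ?(inner_eq0C dv)//.
by rewrite gtrDl le_gtF ?exprn_ge0.
Qed.

Lemma closed_normP (A : set H) :
  (forall l, (forall e : R[i], 0 < e -> exists2 a, A a & `|l - a| < e) -> A l) ->
  closed A.
Proof. by move=> AP l /closure_normP; exact: AP. Qed.

Lemma closed_inner_eq (v : H) (c : R[i]) : closed [set z | inner z v = c].
Proof.
apply: closed_normP => l lim /=.
apply/eqP; rewrite -subr_eq0 -normr_eq0; apply/negPn/negP => n0.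
have n0' : 0 < `|inner l v - c| by rewrite lt_def n0/=.
have v1 : 0 < `|v| + 1 by rewrite ltr_wpDl.
have [a <-] := lim _ (divr_gt0 n0' v1).
rewrite -innerBl ltr_pdivlMr// => /lt_le_trans/(_ (cauchy_schwarz _ _)).
by rewrite mulrDr mulr1 -subr_gt0 opprD addrA subrr add0r oppr_gt0 normr_lt0.
Qed.

End Density.

(** * Fixed vectors of a unitary one-parameter group *)

Section UnitaryIso.
Context (R : realType) (H K : hilbertType R) (A : set H) (B : set K) (f : H -> K).

Lemma unitary_iso_norm v : unitary_iso A B f -> A v -> `|f v| = `|v|.
Proof.
move=> [_ _ fi] Av; apply/eqP; rewrite -(@eqrXn2 _ 2)//.
by rewrite !normE fi.
Qed.

End UnitaryIso.

Section UnitaryGroup.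
Context (R : realType) (E : hilbertType R) (U : R -> E -> E).
Context (hU : unitary_group U).

Lemma unitary_group_lin t : linear_on setT (U t).
Proof. by case: hU => /(_ t)[]. Qed.

Lemma unitary_group_inner t v w : inner (U t v) (U t w) = inner v w.
Proof. by case: hU => /(_ t)[_ _ ->]. Qed.

Lemma unitary_group_norm t v : `|U t v| = `|v|.
Proof. by case: hU => /(_ t) /unitary_iso_norm ->. Qed.

Lemma unitary_groupB t v w : U t (v - w) = U t v - U t w.
Proof. exact: (linear_onB (unitary_group_lin t)). Qed.

Lemma group_fixed_subspace : Defs.subspace (group_fixed U).
Proof.
split=> [t|a v w Uv Uw t]; first exact: (linear_on0 (subspaceT E) (unitary_group_lin t)).
by rewrite unitary_group_lin// Uv Uw.
Qed.

Lemma closed_group_fixed : closed (group_fixed U).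
Proof.
apply: closed_normP => l lim t; apply/eqP; rewrite -subr_eq0 -normr_le0.
apply/ler_addgt0Pr => e e0; rewrite add0r.
have [a aU la] := lim _ (divr_gt0 e0 (ltr0n _ 2)).
have -> : U t l - l = U t (l - a) + (a - l) by rewrite unitary_groupB aU addrA subrK.
rewrite (le_trans (ler_normD _ _))// unitary_group_norm (distrC a).
by rewrite [leRHS](splitr e) lerD// ltW.
Qed.

(** The vector m is the orthogonal projection of w to the fixed vectors, that is,
the ergodic mean of its orbit.  It is only characterized by the closed convex
conditions that it inherits from the forward orbit, as these suffice below.  Only
forward times are involved, so that the result applies to w in Eplus, which is
assumed to be stable under those times alone. *)
Lemma orbit_mean (w : E) :
  exists2 m, group_fixed U m &
    forall B, closed B -> midpoint_closed B -> (forall t, 0 <= t -> B (U t w)) -> B m.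
Proof.
have [_ U0 UD _] := hU.
pose orbit := [set U t w | t in [set t | 0 <= t]].
pose C := smallest (@midpoint_closed R E) orbit.
have Cmid : midpoint_closed C.
  move=> a b Ca Cb B BP; have [Bmid _] := BP.
  by apply: Bmid; [exact: (Ca B BP)|exact: (Cb B BP)].
have orbC : orbit `<=` C by exact: sub_gen_smallest.
have C0 : C !=set0 by exists (U 0 w); apply: orbC; exists 0 => /=.
have [m Cm mfix] := exists_isometry_fixed_point C0 Cmid.
exists m => [|B Bcl Bmid Borb].
  have Ufix t : 0 <= t -> U t m = m.
    move=> t0; apply: mfix => [a b|a|]; [exact: unitary_groupB|exact: unitary_group_norm|].
    apply: smallest_sub => [a b Ca Cb|_ [s /= s0 <-]] /=.
      rewrite (linear_onZ (subspaceT E) (unitary_group_lin t))//.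
      rewrite (linear_onD (unitary_group_lin t))//; exact: Cmid.
    by apply: orbC; exists (t + s); [exact: addr_ge0|exact: UD].
  move=> t; have [|/ltW t0] := leP 0 t; first exact: Ufix.
  by rewrite -{1}(Ufix (- t)) ?oppr_ge0// -UD subrr.
apply: Bcl; move: Cm; apply: closure_subset.
by apply: smallest_sub => // _ [t t0 <-]; exact: Borb.
Qed.

End UnitaryGroup.

(** * Fixed vectors are invariant under the reflection *)

Section ReflectionPositive.
Context (R : realType) (E : hilbertType R) (Eplus : set E)
    (theta : E -> E) (U : R -> E -> E).
Context (hE : reflection_positive_space Eplus theta)
    (hU : reflection_positive_group Eplus theta U).

Let uU : unitary_group U. Proof. by case: hU. Qed.
Let Esub : Defs.subspace Eplus. Proof. by case: hE. Qed.
Let Ecl : closed Eplus. Proof. by case: hE. Qed.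
Let thetaK v : theta (theta v) = v. Proof. by case: hE. Qed.
Let theta_lin : linear_on setT theta. Proof. by case: hE => -[]. Qed.
Let theta_inner v w : inner (theta v) (theta w) = inner v w.
Proof. by case: hE => -[_ _ ->]. Qed.
Let theta_ge0 v : Eplus v -> 0 <= inner (theta v) v.
Proof. by case: hE => _ _ _ _; apply. Qed.
Let U_theta t v : U t (theta v) = theta (U (- t) v).
Proof. by case: hU => _ _ h; rewrite -h thetaK. Qed.

Lemma theta_sym v w : inner (theta v) w = inner v (theta w).
Proof. by rewrite -theta_inner thetaK. Qed.

Lemma Eplus_stable t v : 0 <= t -> Eplus v -> Eplus (U t v).
Proof.
case: uU hU => _ U0 _ _ [_ Upos _].
rewrite le_eqVlt => /orP[/eqP<-|t0 Ev]; first by rewrite U0.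
by apply: (Upos t) => //; exists v.
Qed.

(** Expand the square of theta v - v. *)
Lemma inner_theta_le v : Eplus v -> inner (theta v) v <= `|v| ^+ 2.
Proof.
move=> Ev; have := exprn_ge0 2 (normr_ge0 (theta v - v)).
rewrite (normE (theta v - v)) innerBl !innerBr theta_inner -theta_sym -normE.
by rewrite opprB addrACA -!mulr2n -mulrnDl pmulrn_lge0// subr_ge0.
Qed.

(** The vectors d having a projection m to the fixed vectors with m in Eplus form a
subspace containing all translates of Eplus, hence a dense one.  A fixed v is no
further from m than from d. *)
Lemma group_fixed_Eplus : cyclic_subspace U Eplus -> group_fixed U `<=` Eplus.
Proof.
move=> cyc v vfix; apply: Ecl; apply/closure_normP => e e0.
have [d Ud vd] := dense_normP v cyc e0.
suff [m [mE mfix] dm] : exists2 m, Eplus m /\ group_fixed U m &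
    forall u, group_fixed U u -> inner (d - m) u = 0.
  exists m => //; apply: le_lt_trans vd.
  rewrite -ler_sqr ?nnegrE//.
  have -> : v - d = (v - m) - (d - m) by rewrite opprB addrA subrK.
  have vm : inner (d - m) (v - m) = 0.
    by apply: dm; exact: (subspaceB (group_fixed_subspace uU)).
  by rewrite (pythagoras (inner_eq0C vm)) lerDl exprn_ge0.
move: d Ud {vd}; apply: smallest_sub => [|_ [t _ [w Ew <-]]].
  split.
    exists 0; first by split; [exact: Esub.1 | exact: (group_fixed_subspace uU).1].
    by move=> u _; rewrite subrr inner0l.
  move=> a x y [m [mE mfix] xm] [n [nE nfix] yn].
  exists (a *: m + n).
    by split; [exact: Esub.2 | exact: (group_fixed_subspace uU).2].
  move=> u ufix'; rewrite opprD addrACA -scalerBr innerDl innerZl xm// yn//.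
  by rewrite mulr0 addr0.
have [m mfix mB] := orbit_mean uU w.
exists m.
  split=> //; apply: mB => //; first exact: subspace_midpoint_closed.
  by move=> s s0; exact: Eplus_stable.
move=> u ufix.
have inn s : inner (U s w) u = inner w u.
  by rewrite -{1}(ufix s) unitary_group_inner.
have -> : inner (U t w - m) u = inner w u - inner m u by rewrite innerBl inn.
rewrite (mB [set z | inner z u = inner w u]) ?subrr//.
  exact: closed_inner_eq.
by move=> a b /= au bu; rewrite innerZl innerDl au bu; field.
by move=> s _; exact: inn.
Qed.

(** The vector w = v - theta v is fixed, hence in Eplus, and theta w = - w, so that
inner (theta w) w = - `|w| ^+ 2 contradicts positivity unless w = 0. *)
Lemma group_fixed_theta v : cyclic_subspace U Eplus -> group_fixed U v -> theta v = v.
Proof.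
move=> cyc vfix.
have tfix : group_fixed U (theta v) by move=> t; rewrite U_theta vfix.
pose w := v - theta v.
have wE : Eplus w.
  by apply: group_fixed_Eplus => //; exact: (subspaceB (group_fixed_subspace uU)).
have tw : theta w = - w by rewrite (linear_onB theta_lin)// thetaK opprB.
have := theta_ge0 wE; rewrite tw -scaleN1r innerZl mulN1r oppr_ge0 -normE.
by rewrite real_exprn_even_le0//= normr_eq0 subr_eq0 => /eqP/esym.
Qed.

End ReflectionPositive.

(** * The canonical map and the fixed vectors of the semigroup *)

Section Quotient.
Context (R : realType) (E : hilbertType R) (Eplus : set E)
    (theta : E -> E) (U : R -> E -> E)
    (Ehat : hilbertType R) (q : E -> Ehat) (Uhat : R -> Ehat -> Ehat).
Context (hE : reflection_positive_space Eplus theta)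
    (hU : reflection_positive_group Eplus theta U)
    (hcyc : cyclic_subspace U Eplus)
    (hq : quotient_completion Eplus theta q)
    (hUhat : induced_semigroup Eplus U q Uhat).

Let uU : unitary_group U. Proof. by case: hU. Qed.
Let Esub : Defs.subspace Eplus. Proof. by case: hE. Qed.
Let Ecl : closed Eplus. Proof. by case: hE. Qed.
Let theta_lin : linear_on setT theta. Proof. by case: hE => -[]. Qed.
Let q_lin : linear_on Eplus q. Proof. by case: hq. Qed.
Let fixE : group_fixed U `<=` Eplus. Proof. exact: group_fixed_Eplus hE hU hcyc. Qed.

Lemma quotient_inner v w : Eplus v -> Eplus w ->
  inner (q v) (q w) = inner (theta v) w.
Proof.
move=> Ev Ew; apply/eqP; rewrite -subr_eq0; apply/eqP.
apply: (polarization (D := fun v w => inner (q v) (q w) - inner (theta v) w)) Ev Ew => //.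
- move=> a x y z Ex Ey Ez; rewrite q_lin// theta_lin// !innerDl !innerZl.
  by rewrite mulrBr opprD addrACA.
- move=> a x y z Ex Ey Ez; rewrite q_lin// !innerDr !innerZr.
  by rewrite mulrBr opprD addrACA.
- by move=> x Ex; rewrite -normE; case: hq => _ -> // _; rewrite sqrtCK subrr.
Qed.

Lemma quotient_norm_le v : Eplus v -> `|q v| <= `|v|.
Proof.
move=> Ev; rewrite -ler_sqr ?nnegrE// normE quotient_inner//.
exact: (inner_theta_le hE).
Qed.

Lemma quotient_dist_le v w : Eplus v -> Eplus w -> `|q v - q w| <= `|v - w|.
Proof.
move=> Ev Ew; rewrite -(linear_onB q_lin)//; apply: quotient_norm_le.
exact: subspaceB.
Qed.

Lemma quotient_fixed_inner v w : group_fixed U v -> group_fixed U w ->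
  inner (q v) (q w) = inner v w.
Proof.
move=> vfix wfix; rewrite quotient_inner; [|exact: fixE..].
by rewrite (group_fixed_theta hE hU).
Qed.

Lemma quotient_fixed_dist v w : group_fixed U v -> group_fixed U w ->
  `|q v - q w| = `|v - w|.
Proof.
move=> vfix wfix; rewrite -(linear_onB q_lin); [|exact: fixE..].
have vwfix : group_fixed U (v - w) := subspaceB (group_fixed_subspace uU) vfix wfix.
by apply/eqP; rewrite -(@eqrXn2 _ 2)// !normE quotient_fixed_inner.
Qed.

(** The vectors z of Eplus with q z no further from x than q w form a closed convex
set.  It contains the forward orbit of w, since Uhat t fixes x and contracts
distances. *)
Lemma quotient_mean (x : Ehat) w : semigroup_fixed Uhat x -> Eplus w ->
  exists2 m, group_fixed U m & `|x - q m| <= `|x - q w|.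
Proof.
move=> xfix Ew; have [m mfix mB] := orbit_mean uU w.
exists m => //.
pose B : set E := [set z | Eplus z /\ `|x - q z| <= `|x - q w|].
suff [] : B m by [].
apply: mB.
- apply: closed_normP => l lim.
  have El : Eplus l.
    by apply: Ecl; apply/closure_normP => e /lim[a [Ea _] la]; exists a.
  split=> //; apply/ler_addgt0Pr => e /lim[a [Ea xa] la].
  rewrite -(subrKA (q a)) (le_trans (ler_normD _ _))// lerD//.
  by rewrite (le_trans (quotient_dist_le _ _))// distrC ltW.
- move=> a b [Ea xa] [Eb xb]; split; first exact: subspace_midpoint_closed.
  rewrite (linear_onZ Esub q_lin) ?(linear_onD q_lin)//; last exact: subspaceD.
  have -> : x - 2^-1 *: (q a + q b) = 2^-1 *: ((x - q a) + (x - q b)).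
    have xx : x + x = (2 : R[i]) *: x by rewrite scaler_nat mulr2n.
    by rewrite addrACA -opprD scalerBr xx scalerA mulVf ?scale1r.
  rewrite normrZ ger0_norm ?invr_ge0//.
  rewrite mulrC ler_pdivrMr// (le_trans (ler_normD _ _))//.
  by rewrite mulr_natr mulr2n lerD.
- move=> t t0; split; first exact: (Eplus_stable hU).
  have [Ulin Uctr Uq] := hUhat t0.
  have [_ U0 _ _] := uU.
  move: t0; rewrite le_eqVlt => /orP[/eqP<-|t0]; first by rewrite U0.
  by rewrite -{1}(xfix t t0) -Uq// -(linear_onB Ulin).
Qed.

(** The fixed vectors whose image is within r of x form nested sets; q is isometric
on them, so their diameters shrink with r and completeness applies. *)
Lemma quotient_fixed_surj (x : Ehat) : semigroup_fixed Uhat x ->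
  exists2 v, group_fixed U v & q v = x.
Proof.
move=> xfix.
pose S (r : R[i]) := [set m | group_fixed U m /\ `|x - q m| < r].
have [l lS] : exists l, forall r, 0 < r -> closure (S r) l.
  apply: nested_closure => [r r0|r s r0 rs m [mfix xm]|e e0].
  - have dq : dense (q @` Eplus) by case: hq.
    have [_ [w Ew <-] xw] := dense_normP x dq r0.
    have [m mfix xm] := quotient_mean xfix Ew.
    by exists m; split=> //; exact: le_lt_trans xw.
  - by split=> //; exact: lt_le_trans rs.
  - exists (e / 2); first by rewrite divr_gt0.
    move=> a b [afix xa] [bfix xb].
    rewrite -quotient_fixed_dist// -(subrKA x) (le_lt_trans (ler_normD _ _))//.
    by rewrite (splitr e) ltrD// distrC.
have lfix : group_fixed U l.
  apply: (closed_group_fixed uU); apply: closure_subset (lS 1 ltr01).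
  by move=> m [].
exists l => //; apply/esym/eqP; rewrite -subr_eq0 -normr_le0.
apply/ler_addgt0Pr => e e0; rewrite add0r.
have e2 : 0 < e / 2 by rewrite divr_gt0.
have [a [afix xa] la] := (closure_normP _ _).1 (lS _ e2) _ e2.
rewrite -(subrKA (q a)) (le_trans (ler_normD _ _))// (splitr e) lerD// ?ltW//.
by rewrite quotient_fixed_dist// distrC.
Qed.

(** * Vectors whose whole orbit stays in the positive subspace *)

Lemma Einfty_Eplus v t : Einfty Eplus U v -> Eplus (U t v).
Proof.
have [_ U0 UD _] := uU => vinf.
have Ev : Eplus v.
  by have [a Ea <-] := vinf 1 ltr01; exact: (Eplus_stable hU).
have [t0|t0] := leP 0 t; first exact: (Eplus_stable hU).
have [|a Ea <-] := vinf (- t); first by rewrite /= oppr_gt0.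
by rewrite -UD subrr U0.
Qed.

(** Since theta U s = U (- s) theta, unitarity moves U s to the other argument, where
it joins U t.  What matters is that only s + t remains. *)
Lemma quotient_orbit_inner v s t : Einfty Eplus U v ->
  inner (q (U s v)) (q (U t v)) = inner (theta v) (U (s + t) v).
Proof.
move=> vinf; have [_ U0 UD _] := uU.
rewrite quotient_inner; [|exact: Einfty_Eplus..].
case: hE hU => _ thetaK _ _ _ [_ _ thetaU].
have -> : theta (U s v) = U (- s) (theta v) by rewrite -thetaU thetaK.
by rewrite -(unitary_group_inner uU s) -UD subrr U0 -UD.
Qed.

(** By [quotient_orbit_inner] the inner product of q (U a v) and q (U b v) is the squared
norm g at the midpoint of a and b.  Hence the squared distance of these vectors
is g a + g b minus twice g at the midpoint: its positivity is midpoint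
convexity of g, and it vanishes once g is constant. *)
Lemma quotient_orbit_cst v s t : Einfty Eplus U v -> q (U s v) = q (U t v).
Proof.
move=> vinf.
pose g s := complex.Re (`|q (U s v)| ^+ 2).
have mid a b : inner (q (U a v)) (q (U b v)) = (g (2^-1 * (a + b)))%:C%C.
  rewrite -sqr_norm_real normE !quotient_orbit_inner//.
  by congr (inner _ (U _ _)); field.
have dist a b : `|q (U a v) - q (U b v)| ^+ 2 =
    (g a + g b - 2 * g (2^-1 * (a + b)))%:C%C.
  rewrite normE innerBl !innerBr !mid (addrC b a).
  rewrite -!rmorphB/=; congr (_%:C%C).
  have half (c : R) : 2^-1 * (c + c) = c by field.
  by rewrite !half; ring.
have gcst : forall a b, g a = g b.
  apply: (bounded_midpoint_convex_cst (M := complex.Re (`|v| ^+ 2 : R[i]))) => [a|a b].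
    rewrite -lecR -!sqr_norm_real ler_sqr ?nnegrE//.
    by rewrite -(unitary_group_norm uU a v) quotient_norm_le//; exact: Einfty_Eplus.
  by rewrite -subr_ge0 -lecR -dist exprn_ge0.
apply/eqP; rewrite -subr_eq0 -normr_eq0 -sqrf_eq0 dist.
by rewrite (gcst t s) (gcst (2^-1 * _) s) (_ : _ - _ = 0)//; ring.
Qed.

(** For w in Eplus, inner (theta w) (U r v) equals inner (q w) (q (U r v)), which is
independent of r.  Thus U t v - v and all its translates are orthogonal to
theta w, and moving theta across turns this into orthogonality of
theta (U t v - v) to the translates of Eplus. *)
Lemma Einfty_group_fixed v : Einfty Eplus U v -> group_fixed U v.
Proof.
move=> vinf t; have [_ U0 UD _] := uU.
have [_ thetaK _ _ _] := hE; have [_ _ thetaU] := hU.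
pose z := U t v - v.
suff : theta z = 0.
  move=> tz; apply/eqP; rewrite -subr_eq0 -/z -[z]thetaK tz.
  by rewrite (linear_on0 (subspaceT E) theta_lin).
apply: (orthogonal_dense_span hcyc) => _ [s _ [w Ew <-]].
rewrite -(theta_sym hE).
have -> : theta (U s w) = U (- s) (theta w) by rewrite -thetaU thetaK.
rewrite -(unitary_group_inner uU s) -UD subrr U0 (unitary_groupB uU) -UD innerBr.
have ws r : inner (theta w) (U r v) = inner (q w) (q (U 0 v)).
  by rewrite -quotient_inner//; [rewrite (quotient_orbit_cst r 0)|exact: Einfty_Eplus].
by rewrite !ws subrr.
Qed.

End Quotient.

(** * The fixed vectors of the group *)

Theorem proposition3p8 (R : realType) (E : hilbertType R) (Eplus : set E)
    (theta : E -> E) (U : R -> E -> E)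
    (Ehat : hilbertType R) (q : E -> Ehat) (Uhat : R -> Ehat -> Ehat)
    (hE : reflection_positive_space Eplus theta)
    (hU : reflection_positive_group Eplus theta U)
    (hcyc : cyclic_subspace U Eplus)
    (hq : quotient_completion Eplus theta q)
    (hUhat : induced_semigroup Eplus U q Uhat) :
  [/\ group_fixed U `<=` theta_fixed Eplus theta,
      unitary_iso (group_fixed U) (semigroup_fixed Uhat) q &
      group_fixed U = Einfty Eplus U].
Proof.
have fixE : group_fixed U `<=` Eplus by exact: (group_fixed_Eplus hE hU hcyc).
split.
- by move=> v vfix; split; [exact: fixE | exact: (group_fixed_theta hE hU)].
- split; last by move=> v w; exact: (quotient_fixed_inner hE hU hcyc hq).
  + by case: hq => q_lin _ _ a v w vfix wfix; apply: q_lin; apply: fixE.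
  + split.
    * move=> v vfix t t0; have [_ _ Uq] := hUhat t (ltW t0).
      by rewrite Uq ?vfix//; exact: fixE.
    * move=> v w; rewrite !inE => vfix wfix qvw.
      apply/eqP; rewrite -subr_eq0 -normr_eq0.
      by rewrite -(quotient_fixed_dist hE hU hcyc hq)// qvw subrr normr0.
    * move=> x xfix.
      have [v vfix <-] := quotient_fixed_surj hE hU hcyc hq hUhat xfix.
      by exists v.
- apply/seteqP; split=> v; last exact: (Einfty_group_fixed hE hU hcyc hq).
  by move=> vfix t _; exists v; [exact: fixE | exact: vfix].
Qed.
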